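(* Let $n\ge1$ and let $D:A_n\to A_n$ be a continuous derivation. Then $D(A_n)\subseteq\mathfrak{C}$, where $\mathfrak{C}$ is the commutator ideal of $A_n$.
   Context: $A_n$ is the norm closed algebra $\mathcal{T}^{+}(B_n)$ of the directed graph $B_n$ with one vertex and $n$ edges, i.e. the norm closed unital algebra generated by the left creation operators $L_1,\dots,L_n$ (left multiplication by the $n$ letters) on $\ell^2$ of the free monoid on $n$ letters. A continuous derivation $D:A_n\to A_n$ is a continuous linear map with $D(ab)=D(a)b+aD(b)$ for all $a,b\in A_n$. $\mathfrak{C}$ (also written $\mathfrak{C}_n$) is the (norm closed, two-sided) ideal of $A_n$ generated by the commutators $ab-ba$. *)

(* Defs.v *)
From HB Require Import structures.
From mathcomp Require Import all_boot all_order all_algebra.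
From mathcomp Require Import complex ring.
From mathcomp Require Import all_classical all_reals all_analysis.

Set Implicit Arguments.
Unset Strict Implicit.
Unset Printing Implicit Defensive.

Import Order.TTheory GRing.Theory Num.Theory.
Import numFieldNormedType.Exports.

Local Open Scope classical_set_scope.
Local Open Scope complex_scope.
Local Open Scope ring_scope.

Section SquareModulus.
Variable R : realType.
Local Notation C := R[i].

Definition sqmod (z : C) : R := complex.Re z ^+ 2 + complex.Im z ^+ 2.

Lemma sqmod_ge0 z : 0 <= sqmod z.
Proof. by rewrite addr_ge0 ?sqr_ge0. Qed.

Lemma sqmod0 : sqmod 0 = 0.
Proof. by rewrite /sqmod /= expr0n addr0. Qed.

Lemma sqmodM z w : sqmod (z * w) = sqmod z * sqmod w.
Proof. by case: z w => [a b] [c d]; rewrite /sqmod /=; ring. Qed.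

Lemma sqmod_eq0 z : sqmod z = 0 -> z = 0.
Proof.
case: z => a b /eqP; rewrite /sqmod/= paddr_eq0 ?sqr_ge0// !sqrf_eq0.
by case/andP=> /eqP-> /eqP->.
Qed.

Lemma sqmodD s z w : 0 < s ->
  sqmod (z + w) <= (1 + s) * sqmod z + (1 + s^-1) * sqmod w.
Proof.
case: z w => [a b] [c d] s0; rewrite /sqmod /= -subr_ge0.
suff -> : (1 + s) * (a ^+ 2 + b ^+ 2) + (1 + s^-1) * (c ^+ 2 + d ^+ 2) -
  ((a + c) ^+ 2 + (b + d) ^+ 2) = s^-1 * ((s * a - c) ^+ 2 + (s * b - d) ^+ 2).
  by rewrite mulr_ge0 ?invr_ge0 ?(ltW s0)// addr_ge0 ?sqr_ge0.
by field; rewrite gt_eqF.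
Qed.

Lemma normC_sqmod (z : C) : `|z| = (Num.sqrt (sqmod z))%:C.
Proof. exact: normc_def. Qed.

Lemma le_homogeneous (V : lmodType C) (N : V -> R) :
  (forall x, 0 <= N x) ->
  (forall l x, N (l *: x) <= Num.sqrt (sqmod l) * N x) ->
  forall l x, N (l *: x) = Num.sqrt (sqmod l) * N x.
Proof.
move=> N0 NZ l x; apply/eqP; rewrite eq_le NZ/=.
have [->|l0] := eqVneq l 0; first by rewrite sqmod0 sqrtr0 mul0r.
have sl0 : 0 < Num.sqrt (sqmod l).
  rewrite sqrtr_gt0 lt_neqAle sqmod_ge0 andbT eq_sym.
  by apply: contra_neq l0 => /sqmod_eq0.
rewrite -ler_pdivlMl// -{1}[x](scalerK l0); apply: le_trans (NZ _ _) _.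
rewrite ler_wpM2r// -[leRHS]mulr1 ler_pdivlMl// -sqrtrM ?sqmod_ge0//.
by rewrite -sqmodM mulfV// /sqmod /= expr1n expr0n addr0 sqrtr1.
Qed.

Lemma le_esumZ (T : choiceType) (c : R) (a : T -> R) :
  0 <= c -> (forall w, 0 <= a w) ->
  (\esum_(w in [set: T]) (c * a w)%:E <=
   c%:E * \esum_(w in [set: T]) (a w)%:E)%E.
Proof.
move=> c0 a0; apply: ge_ereal_sup => _ [A [finA AT] <-].
under eq_fsbigr do rewrite EFinM.
rewrite -ge0_mule_fsumr; last by move=> w; rewrite lee_fin.
apply: lee_wpmul2l; first by rewrite lee_fin.
by apply: ereal_sup_ubound; exists A.
Qed.

End SquareModulus.

Section Fock.
Variables (R : realType) (n : nat).
Local Notation C := R[i].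
Local Notation word := (seq 'I_n).
Implicit Types f g : word -> C.

Definition sqsum f : \bar R := (\esum_(w in [set: word]) (sqmod (f w))%:E)%E.

Definition square_summable : {pred (word -> C)} :=
  fun f => `[< (sqsum f < +oo)%E >].

Lemma sqsum_ge0 f : (0 <= sqsum f)%E.
Proof. by apply: esum_ge0 => w _; rewrite lee_fin sqmod_ge0. Qed.

Lemma sqsumZ (l : C) f : (sqsum (l *: f)%R <= (sqmod l)%:E * sqsum f)%E.
Proof.
apply: le_trans (le_esumZ (sqmod_ge0 l) (fun w => sqmod_ge0 (f w))).
by apply: le_esum => w _; rewrite lee_fin -sqmodM.
Qed.

Lemma sqsumD s f g : 0 < s ->
  (sqsum (f + g)%R <= (1 + s)%:E * sqsum f + (1 + s^-1)%:E * sqsum g)%E.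
Proof.
move=> s0.
have s1 : 0 <= 1 + s by rewrite addr_ge0 // ltW.
have s2 : 0 <= 1 + s^-1 by rewrite addr_ge0 // invr_ge0 ltW.
apply: le_trans (leeD (le_esumZ s1 (fun w => sqmod_ge0 (f w)))
                      (le_esumZ s2 (fun w => sqmod_ge0 (g w)))).
rewrite -esumD; last 2 first.
- by move=> w _; rewrite lee_fin mulr_ge0 ?sqmod_ge0.
- by move=> w _; rewrite lee_fin mulr_ge0 ?sqmod_ge0.
by apply: le_esum => w _; rewrite -EFinD lee_fin sqmodD.
Qed.

Lemma sqsum_eq0 f : sqsum f = 0%E -> f = 0.
Proof.
move=> f0; apply/funext => w; apply: sqmod_eq0; apply/eqP.
rewrite eq_le sqmod_ge0 andbT -lee_fin -[X in (_ <= X)%E]f0.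
apply: esum_ge; exists [set w]; first by split.
by rewrite fsbig_set1.
Qed.

Lemma square_summable_submod : submod_closed square_summable.
Proof.
split.
  by apply/asboolP; rewrite /sqsum esum1// => w _; rewrite sqmod0.
move=> l f g /asboolP fS /asboolP gS; apply/asboolP.
apply: le_lt_trans (sqsumD _ _ ltr01) _.
rewrite lte_add_pinfty// lte_mul_pinfty// ?lee_fin ?addr_ge0 ?invr_ge0//.
apply: le_lt_trans (sqsumZ _ _) _.
by rewrite lte_mul_pinfty// lee_fin sqmod_ge0.
Qed.

HB.instance Definition _ :=
  GRing.isSubmodClosed.Build C (word -> C) square_summable
    square_summable_submod.

(* The full Fock space of C^n: l^2 of the free monoid on n letters. *)
Record fock := Fock {
  fock_val :> word -> C;
  fock_valP : fock_val \in square_summable }.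

HB.instance Definition _ := [isSub for fock_val].
HB.instance Definition _ := [Choice of fock by <:].
HB.instance Definition _ := [SubChoice_isSubLmodule of fock by <:].

Definition fock_norm (x : fock) : R := Num.sqrt (fine (sqsum x)).

Lemma fock_norm_ge0 x : 0 <= fock_norm x.
Proof. exact: sqrtr_ge0. Qed.

Lemma sqsum_fin x : sqsum (fock_val x) \is a fin_num.
Proof. by rewrite ge0_fin_numE ?sqsum_ge0//; apply/asboolP/(fock_valP x). Qed.

Lemma sqsum_norm x : sqsum (fock_val x) = (fock_norm x ^+ 2)%:E.
Proof. by rewrite sqr_sqrtr ?fineK ?sqsum_fin// fine_ge0// sqsum_ge0. Qed.

Lemma fock_norm_eq0 x : fock_norm x = 0 -> x = 0.
Proof.
move=> x0; apply: val_inj; apply: (@sqsum_eq0 (fock_val x)).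
by rewrite sqsum_norm x0 expr0n.
Qed.

Lemma fock_normZ l x : fock_norm (l *: x) = Num.sqrt (sqmod l) * fock_norm x.
Proof.
apply: le_homogeneous => [|{}l {}x]; first exact: fock_norm_ge0.
rewrite -sqrtrM ?sqmod_ge0// ler_wsqrtr//.
rewrite -lee_fin EFinM !fineK ?sqsum_fin//; exact: sqsumZ.
Qed.

Lemma fock_norm0 : fock_norm 0 = 0.
Proof. by rewrite -(scale0r 0) fock_normZ sqmod0 sqrtr0 mul0r. Qed.

Lemma fock_normD x y : fock_norm (x + y) <= fock_norm x + fock_norm y.
Proof.
have [/fock_norm_eq0->|x0] := eqVneq (fock_norm x) 0.
  by rewrite add0r lerDr fock_norm_ge0.
have [/fock_norm_eq0->|y0] := eqVneq (fock_norm y) 0.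
  by rewrite addr0 lerDl fock_norm_ge0.
have xgt0 : 0 < fock_norm x by rewrite lt_neqAle eq_sym x0 fock_norm_ge0.
have ygt0 : 0 < fock_norm y by rewrite lt_neqAle eq_sym y0 fock_norm_ge0.
rewrite -ler_sqr ?nnegrE ?addr_ge0 ?fock_norm_ge0//.
have := sqsumD (fock_val x) (fock_val y) (divr_gt0 ygt0 xgt0).
rewrite !sqsum_norm -[(fock_val x + fock_val y)%R]/(fock_val (x + y)).
rewrite sqsum_norm -!EFinM -EFinD lee_fin => /le_trans; apply.
by rewrite le_eqVlt; apply/orP; left; apply/eqP; field; rewrite x0 y0.
Qed.

Let fock_normC x : C := (fock_norm x)%:C.

Let fock_normCD x y : fock_normC (x + y) <= fock_normC x + fock_normC y.
Proof. by rewrite -rmorphD lecR fock_normD. Qed.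

Let fock_normCZ l x : fock_normC (l *: x) = `|l| * fock_normC x.
Proof. by rewrite normC_sqmod -rmorphM -fock_normZ. Qed.

Let fock_normC_eq0 x : fock_normC x = 0 -> x = 0.
Proof. by move/complexI/fock_norm_eq0. Qed.

HB.instance Definition _ := Lmodule_isNormed.Build C fock
  fock_normCD fock_normCZ fock_normC_eq0.

Definition vacuum_fun (w : word) : C := (w == [::])%:R.

Lemma vacuum_summable : vacuum_fun \in square_summable.
Proof.
apply/asboolP; rewrite /sqsum.
rewrite [X in (X < _)%E](_ : _ =
    (\esum_(w in [set [::]]) (sqmod (vacuum_fun w))%:E)%E).
  by rewrite esum_set1 ?ltry// lee_fin sqmod_ge0.
rewrite [RHS]esum_mkcond; apply: eq_esum => w _.
case: ifPn => //; rewrite notin_setE /= => /eqP/negbTE w0.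
by rewrite /vacuum_fun w0 sqmod0.
Qed.

Definition vacuum : fock := Fock vacuum_summable.

Definition bounded_op : {pred (fock -> fock)} := fun T =>
  `[< linear T /\ exists M : R, forall x, fock_norm (T x) <= M * fock_norm x >].

Lemma bounded_op_submod : submod_closed bounded_op.
Proof.
split.
  apply/asboolP; split=> [l x y|]; first by rewrite scaler0 addr0.
  by exists 0 => x; rewrite mul0r fock_norm0.
move=> l S T /asboolP[Slin [M SM]] /asboolP[Tlin [N TN]]; apply/asboolP; split.
  move=> a x y; rewrite -[(l *: S + T) _]/(l *: S _ + T _).
  rewrite -[in RHS]/(a *: (l *: S x + T x) + (l *: S y + T y)).
  rewrite Slin Tlin !scalerDr !scalerA [l * a]mulrC -!addrA; congr (_ + _).
  by rewrite addrCA.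
exists (Num.sqrt (sqmod l) * M + N) => x.
rewrite -[(l *: S + T) _]/(l *: S _ + T _).
apply: le_trans (fock_normD _ _) _.
rewrite fock_normZ mulrDl -mulrA lerD ?TN// ler_wpM2l ?sqrtr_ge0//.
Qed.

HB.instance Definition _ :=
  GRing.isSubmodClosed.Build C (fock -> fock) bounded_op bounded_op_submod.

(* B(H), H the Fock space. *)
Record fock_op := FockOp {
  fock_fun :> fock -> fock;
  fock_funP : fock_fun \in bounded_op }.

HB.instance Definition _ := [isSub for fock_fun].
HB.instance Definition _ := [Choice of fock_op by <:].
HB.instance Definition _ := [SubChoice_isSubLmodule of fock_op by <:].

Implicit Types S T : fock_op.

Lemma fock_opP S T : (forall x, S x = T x) -> S = T.
Proof. by move=> ST; apply: val_inj; apply/funext. Qed.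

Lemma fock_op_linear T : linear T.
Proof. by have /asboolP[] := fock_funP T. Qed.

HB.instance Definition _ T :=
  GRing.isLinear.Build C fock fock *:%R (fock_fun T) (fock_op_linear T).

Lemma id_bounded_op : (id : fock -> fock) \in bounded_op.
Proof. by apply/asboolP; split=> //; exists 1 => x; rewrite mul1r. Qed.

Lemma comp_bounded_op S T : (S \o T : fock -> fock) \in bounded_op.
Proof.
have /asboolP[_ [M SM]] := fock_funP S.
have /asboolP[_ [N TN]] := fock_funP T.
apply/asboolP; split=> [a x y|]; first by rewrite /= !linearP.
exists (`|M| * N) => x /=; apply: le_trans (SM _) _.
apply: le_trans (ler_wpM2r (fock_norm_ge0 _) (ler_norm M)) _.
by rewrite -mulrA ler_wpM2l.
Qed.

Definition fock_op1 := FockOp id_bounded_op.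
Definition fock_opM S T := FockOp (comp_bounded_op S T).

Let fock_opMA : associative fock_opM.
Proof. by move=> S T U; apply: fock_opP. Qed.

Let fock_op1M : left_id fock_op1 fock_opM.
Proof. by move=> T; apply: fock_opP. Qed.

Let fock_opM1 : right_id fock_op1 fock_opM.
Proof. by move=> T; apply: fock_opP. Qed.

Let fock_opMDl : left_distributive fock_opM +%R.
Proof. by move=> S T U; apply: fock_opP. Qed.

Let fock_opMDr : right_distributive fock_opM +%R.
Proof. by move=> S T U; apply: fock_opP => x; exact: (linearD (fock_fun S)). Qed.

Let fock_op1_neq0 : fock_op1 != 0.
Proof.
apply/eqP => /(congr1 (fun T : fock_op => T vacuum [::])).
by move/eqP; rewrite oner_eq0.
Qed.

HB.instance Definition _ := GRing.Zmodule_isNzRing.Build fock_op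
  fock_opMA fock_op1M fock_opM1 fock_opMDl fock_opMDr fock_op1_neq0.

Let fock_opZAl (a : C) S T : a *: (S * T) = (a *: S) * T.
Proof. exact: fock_opP. Qed.

HB.instance Definition _ := GRing.Lmodule_isLalgebra.Build C fock_op fock_opZAl.

Let fock_opZAr (a : C) S T : a *: (S * T) = S * (a *: T).
Proof. by apply: fock_opP => x; rewrite -[RHS]/(S (a *: T x)) linearZ. Qed.

HB.instance Definition _ := GRing.Lalgebra_isAlgebra.Build C fock_op fock_opZAr.

Definition opnorm T : R :=
  sup [set fock_norm (T x) | x in [set x | fock_norm x <= 1]].

Lemma opnorm_has_sup T :
  has_sup [set fock_norm (T x) | x in [set x | fock_norm x <= 1]].
Proof.
split; first by exists (fock_norm (T 0)), 0 => //=; rewrite fock_norm0.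
have /asboolP[_ [M TM]] := fock_funP T.
exists `|M| => _ [x /= x1 <-]; apply: le_trans (TM x) _.
apply: le_trans (ler_wpM2r (fock_norm_ge0 _) (ler_norm M)) _.
by rewrite -[leRHS]mulr1 ler_wpM2l.
Qed.

Lemma le_opnorm1 T x : fock_norm x <= 1 -> fock_norm (T x) <= opnorm T.
Proof. by move=> x1; apply: ub_le_sup; [case: (opnorm_has_sup T)|exists x]. Qed.

Lemma opnorm_le T (M : R) :
  (forall x, fock_norm x <= 1 -> fock_norm (T x) <= M) -> opnorm T <= M.
Proof.
move=> TM; apply: ge_sup; first by case: (opnorm_has_sup T).
by move=> _ [x /= x1 <-]; exact: TM.
Qed.

Lemma opnorm_ge0 T : 0 <= opnorm T.
Proof.
by apply: le_trans (le_opnorm1 T (_ : fock_norm 0 <= 1));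
  rewrite ?fock_norm_ge0 ?fock_norm0.
Qed.

Lemma opnormD S T : opnorm (S + T) <= opnorm S + opnorm T.
Proof.
apply: opnorm_le => x x1; apply: le_trans (fock_normD (S x) (T x)) _.
by rewrite lerD// le_opnorm1.
Qed.

Lemma opnormZ l T : opnorm (l *: T) = Num.sqrt (sqmod l) * opnorm T.
Proof.
apply: le_homogeneous => [|{}l {}T]; first exact: opnorm_ge0.
apply: opnorm_le => x x1; rewrite -[(l *: T) x]/(l *: T x) fock_normZ.
by rewrite ler_wpM2l ?sqrtr_ge0// le_opnorm1.
Qed.

Lemma opnorm_eq0 T : opnorm T = 0 -> T = 0.
Proof.
move=> T0; apply: fock_opP => x; rewrite -[RHS]/(0 : fock).
have [->|x0] := eqVneq x 0; first by rewrite linear0.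
pose c : C := (fock_norm x)^-1%:C.
have nx0 : fock_norm x != 0 by apply: contra_neq x0 => /fock_norm_eq0.
have c0 : c != 0 by rewrite /c fmorph_eq0 invr_eq0.
apply: (scalerI c0); rewrite scaler0 -linearZ; apply: fock_norm_eq0.
apply/eqP; rewrite eq_le fock_norm_ge0 andbT -[leRHS]T0 le_opnorm1//.
rewrite fock_normZ /sqmod /= [0 ^+ 2]expr0n addr0 sqrtr_sqr.
by rewrite ger0_norm ?invr_ge0 ?fock_norm_ge0// mulVf.
Qed.

Let opnormC T : C := (opnorm T)%:C.

Let opnormCD S T : opnormC (S + T) <= opnormC S + opnormC T.
Proof. by rewrite -rmorphD lecR opnormD. Qed.

Let opnormCZ l T : opnormC (l *: T) = `|l| * opnormC T.
Proof. by rewrite normC_sqmod -rmorphM -opnormZ. Qed.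

Let opnormC_eq0 T : opnormC T = 0 -> T = 0.
Proof. by move/complexI/opnorm_eq0. Qed.

HB.instance Definition _ := Lmodule_isNormed.Build C fock_op
  opnormCD opnormCZ opnormC_eq0.

(* Left multiplication by the letter i: L_i e_w = e_(i :: w), whence
   (L_i f)(i :: v) = f v, and L_i f vanishes on the other words. *)
Definition creation_fun (i : 'I_n) f : word -> C :=
  fun w => if w is j :: v then if j == i then f v else 0 else 0.

Lemma sqsum_creation i f : sqsum (creation_fun i f) = sqsum f.
Proof.
rewrite /sqsum.
rewrite [LHS](_ : _ = (\esum_(w in [set i :: v | v in [set: word]])
    (sqmod (creation_fun i f w))%:E)%E).
  rewrite esum_image; last by move=> u v _ _ [].
  by apply: eq_esum => v _ /=; rewrite eqxx.
rewrite [RHS]esum_mkcond; apply: eq_esum => w _.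
case: ifPn => //; rewrite notin_setE /=; case: w => [|j v] /= jv.
  by rewrite sqmod0.
by case: eqP => [ji|_]; [case: jv; exists v; rewrite ?ji|rewrite sqmod0].
Qed.

Lemma creation_summable i (x : fock) : creation_fun i x \in square_summable.
Proof. by apply/asboolP; rewrite sqsum_creation; apply/asboolP/(fock_valP x). Qed.

Definition creation_map i (x : fock) : fock := Fock (creation_summable i x).

Lemma creation_bounded_op i : creation_map i \in bounded_op.
Proof.
apply/asboolP; split.
  move=> a x y; apply: val_inj; apply/funext => -[|j v].
    by rewrite -[RHS]/(a * 0 + 0) mulr0 addr0.
  rewrite -[RHS]/(a * creation_fun i x (j :: v) + creation_fun i y (j :: v)).
  by rewrite /=; case: ifP => // _; rewrite mulr0 addr0.
by exists 1 => x; rewrite mul1r /fock_norm sqsum_creation.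
Qed.

Definition creation i : fock_op := FockOp (creation_bounded_op i).

Definition closed_subalg (A : set fock_op) : Prop :=
  closed A /\ subalg_closed ([in A] : {pred fock_op}).

(* The norm closed unital subalgebra of B(H) generated by L_1, ..., L_n. *)
Definition ncdisc_set : set fock_op :=
  smallest closed_subalg (range creation).

Definition ncdisc_pred : {pred fock_op} := [in ncdisc_set].

Lemma ncdisc_subalg : subalg_closed ncdisc_pred.
Proof.
split.
- by apply/mem_set => A [[_ [A1 _ _]] _]; exact: set_mem.
- move=> a S T /set_mem SA /set_mem TA; apply/mem_set => A /[dup] AP [[_ [_ AL _]] _].
  by apply/set_mem/AL; apply/mem_set; [exact: SA|exact: TA].
- move=> S T /set_mem SA /set_mem TA; apply/mem_set => A /[dup] AP [[_ [_ _ AM]] _].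
  by apply/set_mem/AM; apply/mem_set; [exact: SA|exact: TA].
Qed.

HB.instance Definition _ :=
  GRing.isSubalgClosed.Build C fock_op ncdisc_pred ncdisc_subalg.

Record ncdisc := Ncdisc {
  ncdisc_val :> fock_op;
  ncdisc_valP : ncdisc_val \in ncdisc_pred }.

HB.instance Definition _ := [isSub for ncdisc_val].
HB.instance Definition _ := [Choice of ncdisc by <:].
HB.instance Definition _ := [SubChoice_isSubAlgebra of ncdisc by <:].

Implicit Types a b : ncdisc.

Let ncdisc_norm a : C := `|ncdisc_val a|.

Let ncdisc_normD a b : ncdisc_norm (a + b) <= ncdisc_norm a + ncdisc_norm b.
Proof. exact: ler_normD. Qed.

Let ncdisc_normZ l a : ncdisc_norm (l *: a) = `|l| * ncdisc_norm a.
Proof. exact: normrZ. Qed.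

Let ncdisc_norm_eq0 a : ncdisc_norm a = 0 -> a = 0.
Proof. by move/normr0_eq0 => a0; exact: val_inj. Qed.

HB.instance Definition _ := Lmodule_isNormed.Build C ncdisc
  ncdisc_normD ncdisc_normZ ncdisc_norm_eq0.

Definition closed_ideal (I : set ncdisc) : Prop :=
  [/\ closed I, I 0,
      forall a b, I a -> I b -> I (a + b)
    & forall a b, I b -> I (a * b) /\ I (b * a)].

Definition commutator_ideal : set ncdisc :=
  smallest closed_ideal [set c | exists a b, c = a * b - b * a].

End Fock.

Arguments ncdisc_set R n : clear implicits.
Arguments commutator_ideal R n : clear implicits.

(* Main.v *)
Require Import Defs.
From HB Require Import structures.
From mathcomp Require Import all_boot all_order all_algebra.
From mathcomp Require Import complex ring zify.
From mathcomp Require Import all_classical all_reals all_analysis.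

(** The idea is that a bounded derivation induces a holomorphic vector field on
    the unit ball of [C^n] that is tangent to the sphere, and that such a field
    vanishes.

    An element [a] of the algebra is determined by its Fourier coefficients
    [fourier a w], the coordinates of [a] applied to the vacuum ([toeplitz]).
    Letting the letters commute turns its homogeneous component of degree [d]
    into an ordinary polynomial, whose value at [x] is [peval x d (fourier a)];
    when [x] is a unit vector this value is bounded by [`|a|]
    ([norm_peval_sphere_le]).

    For a unit vector [x] let [S := row_gen x] be the sum of the
    [(x i)^* *: L_i]. It is a contraction whose abelianization is [1] at [x]. By
    the Leibniz rule the value at [x] of the component of degree [d + k] of
    [D (S ^+ k.+1)] is [k.+1] times that of the component of degree [d] of
    [D S]. As [D] is bounded and the powers of [S] are contractions, these values
    stay bounded, so they vanish: with [q_i] the abelianized component of degree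
    [d] of [D L_i], the sum of the [(x i)^* * q_i(x)] is zero on the sphere, and
    on the whole space by homogeneity ([derivation_tangent]). The [q_i] being
    holomorphic, all of them are zero ([tangential_peval_eq0]).

    It remains to see that an element all of whose abelianized components vanish
    lies in every closed ideal [I] that contains the commutators
    ([ideal_of_peval_eq0]). Modulo [I] the letters commute, so each homogeneous
    component of such an element, being a noncommutative polynomial with zero
    abelianization, is in [I] ([closed_ideal_hpoly]). An element is the norm
    limit of its Fejer means ([fejer_cvg]), which are combinations of homogeneous
    components; the means are contractive because they average compressions to
    windows of consecutive word lengths ([opnorm_fejer_le]).

    Hence [I] contains the [D L_i], and the [a] with [D a] in [I] form a closed
    subspace that contains [1] and is stable under left multiplication by the
    [L_i], therefore the whole algebra ([ncdisc_ind]). *)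

Set Implicit Arguments.
Unset Strict Implicit.
Unset Printing Implicit Defensive.

Import Order.TTheory GRing.Theory Num.Theory.
Import numFieldNormedType.Exports.
Local Open Scope classical_set_scope.
Local Open Scope complex_scope.
Local Open Scope ring_scope.

(** * Square moduli *)

(** With [z] the sum of the [c i * m i] and [M] that of the [`|m i| ^+ 2], the
    defect of the inequality, multiplied by [M], is the sum of squares
    [\sum_i `|M * c i - z * (m i)^*| ^+ 2]. *)
Lemma cauchy_schwarz_closed (F : numClosedFieldType) (I : finType)
    (c m : I -> F) :
  `|\sum_i c i * m i| ^+ 2 <= (\sum_i `|c i| ^+ 2) * (\sum_i `|m i| ^+ 2).
Proof.
set z := \sum_i c i * m i; set M := \sum_i `|m i| ^+ 2.
have M0 : 0 <= M by apply: sumr_ge0 => i _; exact: exprn_ge0.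
have [M_eq0|M_neq0] := eqVneq M 0.
  rewrite M_eq0 mulr0 /z big1 ?normr0 ?expr0n// => i _.
  have /(_ i isT)/eqP :=
    psumr_eq0P (fun i _ => exprn_ge0 2 (normr_ge0 (m i))) M_eq0.
  by rewrite expf_eq0/= normr_eq0 => /eqP->; rewrite mulr0.
have M_gt0 : 0 < M by rewrite lt_neqAle eq_sym M_neq0.
rewrite -subr_ge0 -(pmulr_rge0 _ M_gt0).
have -> : M * ((\sum_i `|c i| ^+ 2) * M - `|z| ^+ 2) =
    \sum_i `|M * c i - z * Num.conj (m i)| ^+ 2.
  have -> : \sum_i `|M * c i - z * Num.conj (m i)| ^+ 2 =
      \sum_i (M * M * `|c i| ^+ 2 - M * Num.conj z * (c i * m i)
              - M * z * Num.conj (c i * m i) + z * Num.conj z * `|m i| ^+ 2).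
    apply: eq_bigr => i _.
    rewrite !normCK rmorphB !rmorphM/= conjCK (geC0_conj M0); ring.
  rewrite !big_split/= !sumrN -!mulr_sumr -rmorph_sum -/z -/M !normCK; ring.
by apply: sumr_ge0 => i _; exact: exprn_ge0.
Qed.

Section SquareModulusSums.
Variable R : realType.
Local Notation C := R[i].

Lemma sqmodC (z : C) : (sqmod z)%:C = `|z| ^+ 2.
Proof. by rewrite normC_sqmod -rmorphXn/= sqr_sqrtr ?sqmod_ge0. Qed.

Lemma sqmod_real (r : R) : sqmod r%:C = r ^+ 2.
Proof. by rewrite /sqmod/= expr0n addr0. Qed.

Lemma cauchy_schwarz_sqmod (I : finType) (c m : I -> C) :
  sqmod (\sum_i c i * m i) <= (\sum_i sqmod (c i)) * (\sum_i sqmod (m i)).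
Proof.
rewrite -lecR rmorphM !rmorph_sum/= sqmodC.
under [X in _ <= _ * X]eq_bigr do rewrite sqmodC.
under [X in _ <= X * _]eq_bigr do rewrite sqmodC.
exact: cauchy_schwarz_closed.
Qed.

Lemma sqmod_sum_le (I : finType) (c : I -> C) :
  sqmod (\sum_i c i) <= #|I|%:R * \sum_i sqmod (c i).
Proof.
have := cauchy_schwarz_sqmod c (fun=> 1).
under eq_bigr do rewrite mulr1.
by rewrite sumr_const (sqmod_real 1) expr1n mulrC.
Qed.

(** Nonnegative complex numbers are real, hence bounded by natural numbers. *)
Lemma archi_complex (x : C) : 0 <= x -> exists N, x < N.+1%:R.
Proof.
move=> /ger0_norm <-; rewrite normC_sqmod.
have := archi_boundP (sqrtr_ge0 (sqmod x)).
set N := Num.bound _ => xN; exists N; rewrite -(rmorph_nat (real_complex R)).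
by rewrite ltcR (lt_trans xN)// ltr_nat.
Qed.

Lemma bounded_multiples_eq0 (z M : C) :
  (forall k, k.+1%:R * `|z| <= M) -> z = 0.
Proof.
move=> zM; have M0 : 0 <= M by apply: le_trans (zM 0%N); rewrite mul1r.
apply/eqP/negPn/negP; rewrite -normr_gt0 => z_gt0.
have [N] := archi_complex (divr_ge0 M0 (normr_ge0 z)).
by rewrite ltr_pdivrMr// => /(le_lt_trans (zM N)); rewrite ltxx.
Qed.

End SquareModulusSums.

(** * Normed modules over a number field *)

Section NormedModules.
Variables (K : numFieldType) (V W : normedModType K).

Lemma linear_lipschitz_continuous (f : {linear V -> W}) (M : K) :
  (forall x, `|f x| <= M * `|x|) -> 0 <= M -> continuous f.
Proof.
move=> fM M0; apply: bounded_linear_continuous; apply/linear_boundedP.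
near=> r => x; apply: le_trans (fM x) _; rewrite ler_wpM2r//.
by near: r; apply: nbhs_pinfty_ge; rewrite ger0_real.
Unshelve. all: by end_near. Qed.

Lemma continuous_linear_lipschitz (f : {linear V -> W}) : continuous f ->
  exists2 M : K, 0 <= M & forall x, `|f x| <= M * `|x|.
Proof.
move=> fc; have /linear_boundedP/pinfty_ex_gt0[M M0 fM] :=
  continuous_linear_bounded 0 (fc 0).
by exists M => //; exact: ltW.
Qed.

Lemma closed_normP (I : set V) :
  closed I <->
  (forall a, (forall e : K, 0 < e -> exists2 b, I b & `|a - b| < e) -> I a).
Proof.
split=> [cI a aI|cI a aI].
  apply: cI; rewrite closureEnbhs => U B IU /nbhs_normP[e e0 eB].
  have [b Ib ab] := aI _ e0.
  by exists b; split; [exact: IU|exact: eB].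
apply: cI => e e0.
have [b [Ib /= ab]] : I `&` ball a e !=set0.
  by apply: aI; exact: nbhsx_ballx.
by exists b => //; move: ab; rewrite -ball_normE.
Qed.

(** Stated for additive maps, so that it applies to functionals without packaging
    them as linear maps. *)
Lemma closed_kernel (F : V -> W) (M : K) :
  0 <= M -> (forall a b, F (a - b) = F a - F b) ->
  (forall a, `|F a| <= M * `|a|) -> closed [set a | F a = 0].
Proof.
move=> M0 FB FM; apply/closed_normP => a aI /=; apply/normr0_eq0/eqP.
rewrite eq_le normr_ge0 andbT; apply/ler_addgt0Pl => e e0; rewrite addr0.
have M1 : 0 < 1 + M by rewrite ltr_wpDr.
have [b /= Fb ab] := aI _ (divr_gt0 e0 M1).
rewrite -[F a]subr0 -Fb -FB; apply: le_trans (FM _) _.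
apply: (@le_trans _ _ (M * (e / (1 + M)))); first by rewrite ler_wpM2l// ltW.
by rewrite mulrCA ler_piMr ?ltW// ltr_pdivrMr// mul1r ltrDr.
Qed.

End NormedModules.

(** * Operators on the Fock space and the algebra of the creation operators *)

Section FockBasics.
Variables (R : realType) (n : nat).
Local Notation C := R[i].
Local Notation word := (seq 'I_n).
Local Notation fock := (fock R n).
Local Notation fock_op := (fock_op R n).
Local Notation A := (ncdisc R n).
Implicit Types (f : word -> C) (x y : fock) (S T : fock_op) (a b : A).

Lemma sqmod_le_sqsum f w : ((sqmod (f w))%:E <= sqsum f)%E.
Proof.
by apply: esum_ge; exists [set w]; [split|rewrite fsbig_set1].
Qed.

Lemma sqmod_coord_le x w : sqmod (x w) <= fock_norm x ^+ 2.
Proof. by rewrite -lee_fin -sqsum_norm sqmod_le_sqsum. Qed.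

(** Words are split according to their first letter; the words that start with
    [i] form the range of the [i]-th creation operator, an isometry. *)
Lemma sqsum_cons f :
  sqsum f = ((sqmod (f [::]))%:E + \sum_(i < n) sqsum (fun w => f (i :: w)))%E.
Proof.
have pos (g : word -> C) w : (0 <= (sqmod (g w))%:E)%E.
  by rewrite lee_fin sqmod_ge0.
have -> : ((sqmod (f [::]))%:E =
    \esum_(w in [set: word]) (if w is [::] then sqmod (f [::]) else 0)%:E)%E.
  rewrite -[LHS](@esum_set1 _ _ [::] (fun w => (sqmod (f w))%:E))//.
  rewrite esum_mkcond; apply: eq_esum => -[|j v] _; case: ifPn => //.
    by rewrite notin_setE /=.
  by rewrite inE.
under eq_bigr => i _ do rewrite -(sqsum_creation i).
rewrite -esum_sum -?esumD; first last.
- by move=> i w _ _; exact: pos.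
- by move=> w _; apply: sume_ge0 => i _; exact: pos.
- by move=> [|j v] _; rewrite lee_fin// sqmod_ge0.
apply: eq_esum => -[|j v] _ /=.
  by rewrite big1 ?adde0// => i _; rewrite sqmod0.
rewrite add0e (bigD1 j)//= eqxx big1 ?adde0// => i ij.
by rewrite eq_sym (negbTE ij) sqmod0.
Qed.

Lemma opnormP T x : fock_norm (T x) <= opnorm T * fock_norm x.
Proof.
have [->|x0] := eqVneq x 0; first by rewrite linear0 fock_norm0 mulr0.
have nx_neq0 : fock_norm x != 0 by apply: contra_neq x0 => /fock_norm_eq0.
have nx_gt0 : 0 < fock_norm x by rewrite lt_neqAle eq_sym nx_neq0 fock_norm_ge0.
have inv_sqmod : Num.sqrt (sqmod ((fock_norm x)^-1%:C)) = (fock_norm x)^-1.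
  by rewrite sqmod_real sqrtr_sqr ger0_norm// invr_ge0 ltW.
have := @le_opnorm1 _ _ T ((fock_norm x)^-1%:C *: x).
rewrite linearZ/= !fock_normZ inv_sqmod mulVf// => /(_ (lexx _)).
by rewrite ler_pdivrMl// mulrC.
Qed.

Lemma opnorm_le_sqr T (M : R) : 0 <= M ->
  (forall x, fock_norm (T x) ^+ 2 <= M ^+ 2 * fock_norm x ^+ 2) -> opnorm T <= M.
Proof.
move=> M0 TM; apply: opnorm_le => x x1.
rewrite -ler_sqr ?nnegrE ?fock_norm_ge0//; apply: le_trans (TM x) _.
by rewrite ler_piMr ?sqr_ge0// expr_le1 ?fock_norm_ge0.
Qed.

Lemma opnormM S T : opnorm (S * T) <= opnorm S * opnorm T.
Proof.
apply: opnorm_le => x x1; apply: le_trans (opnormP S (T x)) _.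
by rewrite ler_wpM2l ?opnorm_ge0// le_opnorm1.
Qed.

Lemma ncdisc_normE a : `|a| = (opnorm a)%:C.
Proof. by []. Qed.

Lemma ncdisc_normM a b : `|a * b| <= `|a| * `|b|.
Proof. by rewrite !ncdisc_normE -rmorphM lecR; exact: opnormM. Qed.

Lemma ncdisc_norm1 : `|1 : A| <= 1.
Proof.
by rewrite ncdisc_normE -[leRHS]/(1%:C) lecR; apply: opnorm_le.
Qed.

Lemma ncdisc_mulr_continuous b : continuous (fun a => a * b).
Proof.
pose f : {linear A -> A} := b \o* idfun.
apply: (@linear_lipschitz_continuous C A A f `|b|) => // a.
by rewrite /= [leRHS]mulrC ncdisc_normM.
Qed.

Lemma ncdisc_gen_subproof (i : 'I_n) :
  creation R i \in (ncdisc_pred (R := R) (n := n)).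
Proof. by apply/mem_set => B [_ +]; apply; exists i. Qed.

Definition ncdisc_gen i : A := Ncdisc (ncdisc_gen_subproof i).

(** A closed subalgebra of the subtype [ncdisc] has a closed image among all
    operators, because [ncdisc] is itself closed there and carries the operator
    norm; minimality of [ncdisc_set] then applies to that image. *)
Lemma ncdisc_subalg_ind (V : set A) : closed V ->
  V 1 -> (forall (l : C) a b, V a -> V b -> V (l *: a + b)) ->
  (forall a b, V a -> V b -> V (a * b)) ->
  (forall i, V (ncdisc_gen i)) -> forall a, V a.
Proof.
move=> /closed_normP cV V1 VL VM Vg a.
pose W := (ncdisc_val (R := R) (n := n)) @` V.
have WE b : W (ncdisc_val b) -> V b.
  by case=> c Vc /val_inj <-.
suff /WE : W (ncdisc_val a) by [].
have := ncdisc_valP a => /set_mem; apply; split; last first.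
  by move=> _ [i _ <-]; exists (ncdisc_gen i).
split; last first.
  split.
  - by apply/mem_set; exists 1.
  - move=> l _ _ /set_mem[b Vb <-] /set_mem[c Vc <-]; apply/mem_set.
    by exists (l *: b + c) => //; exact: VL.
  - move=> _ _ /set_mem[b Vb <-] /set_mem[c Vc <-]; apply/mem_set.
    by exists (b * c) => //; exact: VM.
move=> T WT.
have AT : T \in ncdisc_pred (R := R) (n := n).
  apply/mem_set => B /[dup] BP [[cB _] _]; apply: cB.
  apply: closureS WT => _ [b _ <-].
  by have /set_mem := ncdisc_valP b; apply.
exists (Ncdisc AT) => //; apply: cV => e e0.
have [_ [[b Vb <-] /= ab]] : W `&` ball T e !=set0.
  by apply: WT; exact: nbhsx_ballx.
by exists b => //; move: ab; rewrite -ball_normE.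
Qed.

(** Stability under products, which is awkward for sets such as a space of
    approximable elements, can be weakened to stability under left
    multiplication by the generators: the [a] with [a * b] in [V] for every [b]
    in [V] form a closed subalgebra, and [V] contains [1]. *)
Lemma ncdisc_ind (V : set A) : closed V ->
  V 1 -> (forall (l : C) a b, V a -> V b -> V (l *: a + b)) ->
  (forall i a, V a -> V (ncdisc_gen i * a)) -> forall a, V a.
Proof.
move=> cV V1 VL Vg a; rewrite -(mulr1 a).
pose W : set A := fun a : A => forall b, V b -> V (a * b).
suff : W a by apply.
move: a; apply: (@ncdisc_subalg_ind W) =>
    [||l a b Va Vb c Vc|a b Va Vb c Vc|i b].
- rewrite [X in closed X](_ : _ = \bigcap_(b in V) (fun a => a * b) @^-1` V) //.
  apply: closed_bigI => b Vb; apply: preimage_closed => //.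
  by move=> a _; exact: ncdisc_mulr_continuous.
- by move=> b; rewrite mul1r.
- by rewrite mulrDl -scalerAl; apply: VL; [exact: Va|exact: Vb].
- by rewrite -mulrA; apply: Va; exact: Vb.
- exact: Vg.
Qed.

End FockBasics.

(** * Fourier coefficients *)

Section Toeplitz.
Variables (R : realType) (n : nat).
Local Notation C := R[i].
Local Notation word := (seq 'I_n).
Local Notation fock := (fock R n).
Local Notation fock_op := (fock_op R n).
Local Notation A := (ncdisc R n).
Local Notation gen := (@ncdisc_gen R n).
Local Notation vac := (@vacuum R n).
Implicit Types (f : word -> C) (x y : fock) (a b : A) (u v w : word).

(** The coefficient of [L_w] in the formal series of [a]: applying that series
    to the vacuum vector gives the vector with coordinates [fourier a]. *)
Definition fourier a w : C := a vac w.

Lemma fourier_is_linear : linear fourier.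
Proof. by []. Qed.

HB.instance Definition _ :=
  GRing.isLinear.Build C A (word -> C) *:%R fourier fourier_is_linear.

Lemma norm_coord_le x w : `|x w| <= `|x|.
Proof.
rewrite -(@ler_pXn2r _ 2) ?nnegrE// -sqmodC.
by rewrite -[X in _ <= X ^+ 2]/((fock_norm x)%:C) -rmorphXn lecR sqmod_coord_le.
Qed.

Lemma norm_apply_le a x : `|(a : fock_op) x| <= `|a| * `|x|.
Proof.
rewrite -[leLHS]/((fock_norm _)%:C) -[leRHS](rmorphM (real_complex R)) lecR.
exact: opnormP.
Qed.

Lemma sqsum_vacuum : sqsum vac = 1%E.
Proof.
rewrite sqsum_cons big1 => [|i _].
  by rewrite adde0 /= /vacuum_fun eqxx /sqmod /= expr1n expr0n addr0.
by rewrite /sqsum esum1// => w _; rewrite /= /vacuum_fun sqmod0.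
Qed.

Lemma norm_vacuum : `|vac| = 1.
Proof.
by rewrite -[LHS]/((fock_norm _)%:C) /fock_norm sqsum_vacuum/= sqrtr1.
Qed.

Lemma norm_fourier_le a w : `|fourier a w| <= `|a|.
Proof.
apply: le_trans (norm_coord_le _ _) _.
by rewrite -[leRHS]mulr1 -norm_vacuum norm_apply_le.
Qed.

Lemma gen_apply i a x u :
  (gen i * a : fock_op) x u = creation_fun i (a x) u.
Proof. by []. Qed.

Lemma gen_fourier i a w : fourier (gen i * a) w = creation_fun i (fourier a) w.
Proof. by []. Qed.

(** The product of formal series in noncommuting letters. *)
Definition convol f (g : word -> C) u : C :=
  \sum_(k < (size u).+1) f (take k u) * g (drop k u).

Lemma convol_nil f (g : word -> C) : convol f g [::] = f [::] * g [::].
Proof. by rewrite /convol big_ord_recl big_ord0 addr0. Qed.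

Lemma convol_cons f (g : word -> C) i u :
  convol f g (i :: u) = f [::] * g (i :: u) + convol (fun w => f (i :: w)) g u.
Proof. by rewrite /convol big_ord_recl. Qed.

Lemma convolP (l : C) f1 f2 (g : word -> C) u :
  convol (l *: f1 + f2) g u = l * convol f1 g u + convol f2 g u.
Proof.
rewrite /convol mulr_sumr -big_split; apply: eq_bigr => k _ /=.
by rewrite -[(l *: f1 + f2) _]/(l * f1 _ + f2 _) mulrDl mulrA.
Qed.

Lemma convol1 (g : word -> C) u : convol (fourier 1) g u = g u.
Proof.
case: u => [|i u]; first by rewrite convol_nil /fourier/= /vacuum_fun eqxx mul1r.
rewrite convol_cons /fourier/= /vacuum_fun eqxx mul1r /convol big1 ?addr0// => k _.
by rewrite mul0r.
Qed.

(** The elements of the algebra act as their formal series do. Both sides are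
    continuous in [a] for fixed [x] and [u], and left multiplication by [L_i]
    shifts both in the same way. *)
Lemma toeplitz a x u : a x u = convol (fourier a) x u.
Proof.
pose F (x : fock) u (a : A) : C^o := a x u - convol (fourier a) x u.
suff : [set a | forall x u, F x u a = 0] a.
  by move=> /(_ x u)/eqP; rewrite subr_eq0 => /eqP.
have FP z w (l : C) (b c : A) : F z w (l *: b + c) = l * F z w b + F z w c.
  rewrite /F linearP convolP -[(l *: b + c : fock_op) z w]/(l * b z w + c z w).
  ring.
move: a; apply: ncdisc_ind => [||l a b Fa Fb z w|i a Fa z w].
(* the right-hand side has finitely many terms, each Lipschitz in a *)
- rewrite [X in closed X](_ : _ = \bigcap_z \bigcap_w [set a | F z w a = 0]).
    apply: closed_bigI => z _; apply: closed_bigI => w _.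
    apply: (@closed_kernel C A C^o (F z w)
        (`|z| + \sum_(k < (size w).+1) `|z (drop k w)|)).
    - by rewrite addr_ge0// sumr_ge0.
    - by move=> b c; rewrite addrC -scaleN1r FP mulN1r addrC.
    - move=> b; apply: le_trans (ler_normB _ _) _; rewrite mulrDl lerD//.
        apply: le_trans (norm_coord_le _ _) _.
        by rewrite mulrC norm_apply_le.
      apply: le_trans (ler_norm_sum _ _ _) _; rewrite mulr_suml ler_sum// => k _.
      by rewrite normrM mulrC ler_wpM2l// norm_fourier_le.
  by apply/seteqP; split=> b /= Fb => [z _ w _|z w]; exact: Fb.
- by move=> z w; rewrite /F convol1 subrr.
- by rewrite FP Fa Fb mulr0 addr0.
- rewrite /F gen_apply; apply/eqP; rewrite subr_eq0; apply/eqP.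
  case: w => [|j w]; first by rewrite convol_nil gen_fourier mul0r.
  rewrite convol_cons gen_fourier mul0r add0r /=.
  have /eqP := Fa z w; rewrite subr_eq0 => /eqP ->.
  case: ifPn => ji; rewrite /convol.
    by apply: eq_bigr => k _; rewrite gen_fourier/= ji.
  by rewrite big1// => k _; rewrite gen_fourier/= (negbTE ji) mul0r.
Qed.

Lemma fourier_inj : injective fourier.
Proof.
move=> a b ab; apply: val_inj; apply: fock_opP => x; apply: val_inj.
by apply/funext => u; rewrite /= !toeplitz ab.
Qed.

Lemma fourier_mul_gen a i w j :
  fourier (a * gen i) (rcons w j) = if j == i then fourier a w else 0.
Proof.
rewrite [LHS](_ : _ = a (gen i vac) (rcons w j))// toeplitz.
elim: w (fourier a) => [|k w IH] f /=.
  rewrite convol_cons convol_nil /= /vacuum_fun mulr0 addr0.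
  by case: ifP; rewrite ?mulr0 ?mulr1.
rewrite convol_cons IH /= /vacuum_fun.
by rewrite (_ : rcons w j == [::] = false) ?if_same ?mulr0 ?add0r//; case: (w).
Qed.

End Toeplitz.

(** * Homogeneous noncommutative polynomials *)

Section HomogeneousPolynomials.
Variables (K : comNzRingType) (n : nat).
Local Notation word := (seq 'I_n).

Fixpoint words d : seq word :=
  if d is d'.+1 then [seq i :: w | i <- enum 'I_n, w <- words d'] else [:: [::]].

Lemma size_words d w : w \in words d -> size w = d.
Proof.
elim: d w => [|d IH] w; first by rewrite inE => /eqP->.
by case/allpairsP => -[i v] /= [_ /IH vd ->]; rewrite /= vd.
Qed.

Section Evaluation.
Variables (B : algType K).
Implicit Types (L : 'I_n -> B) (c : word -> K^o).

(** The homogeneous polynomial of degree [d] with coefficients [c], evaluated at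
    the elements [L i] of any algebra: at the generators of [ncdisc] it is a
    homogeneous component, at polynomials in one variable it is the restriction
    of its abelianization to a curve. *)
Definition hpoly L d c : B := \sum_(w <- words d) c w *: \prod_(i <- w) L i.

Lemma hpoly0 L c : hpoly L 0 c = (c [::])%:A.
Proof. by rewrite /hpoly big_seq1 big_nil. Qed.

Lemma hpolyS L d c :
  hpoly L d.+1 c = \sum_i L i * hpoly L d (fun w => c (i :: w)).
Proof.
rewrite /hpoly /= big_allpairs_dep big_enum; apply: eq_bigr => i _.
rewrite mulr_sumr; apply: eq_bigr => w _.
by rewrite big_cons scalerAr.
Qed.

Lemma hpolySr L d c :
  hpoly L d.+1 c = \sum_i hpoly L d (fun w => c (rcons w i)) * L i.
Proof.
elim: d c => [|d IH] c.
  by rewrite hpolyS; apply: eq_bigr => i _; rewrite !hpoly0 mulr_algr mulr_algl.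
rewrite hpolyS; under eq_bigr do rewrite IH mulr_sumr.
rewrite exchange_big; apply: eq_bigr => i _; rewrite hpolyS mulr_suml.
by apply: eq_bigr => j _; rewrite mulrA.
Qed.

End Evaluation.

(** The case [B := K^o] of [hpoly], restated in the ring [K] itself so that
    the ring operations of [K] appear in the lemmas rather than those of the
    regular algebra. *)
Definition peval (x : 'I_n -> K) d (c : word -> K) : K :=
  \sum_(w <- words d) c w * \prod_(i <- w) x i.

Lemma peval0 x c : peval x 0 c = c [::].
Proof. by rewrite /peval big_seq1 big_nil mulr1. Qed.

Lemma pevalS x d c : peval x d.+1 c = \sum_i x i * peval x d (fun w => c (i :: w)).
Proof. exact: (hpolyS (B := K^o)). Qed.

Lemma pevalSr x d c :
  peval x d.+1 c = \sum_i peval x d (fun w => c (rcons w i)) * x i.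
Proof. exact: (hpolySr (B := K^o)). Qed.

Lemma pevalZ x d l (c : word -> K) : peval x d (fun w => l * c w) = l * peval x d c.
Proof. by rewrite /peval mulr_sumr; apply: eq_bigr => w _; rewrite mulrA. Qed.

Lemma peval_sum (I : finType) x d (c : I -> word -> K) :
  peval x d (fun w => \sum_i c i w) = \sum_i peval x d (c i).
Proof.
rewrite /peval exchange_big; apply: eq_bigr => w _.
by rewrite mulr_suml.
Qed.

Lemma horner_hpoly (L : 'I_n -> {poly K}) d c t :
  (hpoly L d c).[t] = peval (fun i => (L i).[t]) d c.
Proof.
rewrite /hpoly horner_sum; apply: eq_bigr => w _.
by rewrite hornerZ horner_prod.
Qed.

Lemma peval_scale (x : 'I_n -> K) s d c :
  peval (fun i => s * x i) d c = s ^+ d * peval x d c.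
Proof.
elim: d c => [|d IH] c; first by rewrite !peval0 mul1r.
rewrite !pevalS mulr_sumr; apply: eq_bigr => i _; rewrite IH exprS; ring.
Qed.

End HomogeneousPolynomials.

(** * Evaluation at points of the unit sphere *)

Section UnitSphere.
Variables (R : realType) (n : nat).
Local Notation C := R[i].
Local Notation word := (seq 'I_n).
Local Notation A := (ncdisc R n).
Local Notation gen := (@ncdisc_gen R n).
Variables (x : 'I_n -> C).
Hypothesis x1 : \sum_i sqmod (x i) = 1.

(** Cauchy-Schwarz on each letter in turn: the monomials of degree [d] at a
    point of the unit sphere have square moduli of sum [1]. *)
Lemma peval_sphere_le (c : word -> C) d :
  ((sqmod (peval x d c))%:E <= sqsum c)%E.
Proof.
elim: d c => [|d IH] c.
  by rewrite peval0 sqmod_le_sqsum.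
rewrite pevalS sqsum_cons.
apply: (@le_trans _ _ (\sum_(i < n) sqsum (fun w => c (i :: w)))%E); last first.
  by rewrite leeDr// lee_fin sqmod_ge0.
apply: (@le_trans _ _ (\sum_(i < n)
    sqmod (peval x d (fun w => c (i :: w))))%:E%E).
  rewrite lee_fin; apply: le_trans (cauchy_schwarz_sqmod _ _) _.
  by rewrite x1 mul1r.
by rewrite -sumEFin lee_sum.
Qed.

Lemma norm_peval_sphere_le (a : A) d : `|peval x d (fourier a)| <= `|a|.
Proof.
rewrite -(@ler_pXn2r _ 2) ?nnegrE// -sqmodC.
apply: (@le_trans _ _ (`|(a : fock_op R n) (vacuum R n)| ^+ 2)).
  rewrite -[X in _ <= X ^+ 2]/((fock_norm _)%:C) -rmorphXn lecR -lee_fin.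
  by rewrite -sqsum_norm peval_sphere_le.
rewrite ler_pXn2r ?nnegrE//.
by rewrite -[leRHS]mulr1 -(norm_vacuum R n) norm_apply_le.
Qed.

(** The coefficients are conjugated so that, [x] being a unit vector, the
    abelianization takes the value [1] at [x]: multiplying by [row_gen] on either
    side preserves the values at [x] of the homogeneous components, apart from a
    shift of the degree. It is a contraction because the ranges of the [L_i] are
    orthogonal. *)
Definition row_gen : A := \sum_i Num.conj (x i) *: gen i.

Lemma row_gen_fourier_nil (a : A) : fourier (row_gen * a) [::] = 0.
Proof.
rewrite /row_gen mulr_suml linear_sum/= fct_sumE big1// => i _.
by rewrite -scalerAl linearZ/= -[LHS]/(_ * _) gen_fourier mulr0.
Qed.

Lemma row_gen_fourier_cons (a : A) j w :
  fourier (row_gen * a) (j :: w) = Num.conj (x j) * fourier a w.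
Proof.
rewrite /row_gen mulr_suml linear_sum/= fct_sumE (bigD1 j)//= big1 => [|i ij].
  by rewrite addr0 -scalerAl linearZ/= -[LHS]/(_ * _) gen_fourier/= eqxx.
rewrite -scalerAl linearZ/= -[LHS]/(_ * _) gen_fourier/= eq_sym.
by rewrite (negbTE ij) mulr0.
Qed.

Lemma fourier_mul_row_gen_rcons (a : A) j w :
  fourier (a * row_gen) (rcons w j) = Num.conj (x j) * fourier a w.
Proof.
rewrite /row_gen mulr_sumr linear_sum/= fct_sumE (bigD1 j)//= big1 => [|i ij].
  by rewrite addr0 -scalerAr linearZ/= -[LHS]/(_ * _) fourier_mul_gen/= eqxx.
rewrite -scalerAr linearZ/= -[LHS]/(_ * _) fourier_mul_gen/= eq_sym.
by rewrite (negbTE ij) mulr0.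
Qed.

Let xx1 : \sum_i x i * Num.conj (x i) = 1.
Proof.
rewrite -[RHS]/((1 : R)%:C) -x1 rmorph_sum.
by under [RHS]eq_bigr => i _ do rewrite /= sqmodC normCK.
Qed.

Lemma peval_row_gen_mul (a : A) d :
  peval x d.+1 (fourier (row_gen * a)) = peval x d (fourier a).
Proof.
rewrite pevalS -[RHS]mul1r -[in RHS]xx1 [RHS]mulr_suml; apply: eq_bigr => i _.
rewrite -mulrA; congr (_ * _); rewrite -pevalZ; congr (peval _ _ _).
by apply/funext => w; rewrite row_gen_fourier_cons.
Qed.

Lemma peval_mul_row_gen (a : A) d :
  peval x d.+1 (fourier (a * row_gen)) = peval x d (fourier a).
Proof.
rewrite pevalSr -[RHS]mul1r -[in RHS]xx1 [RHS]mulr_suml; apply: eq_bigr => i _.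
rewrite mulrC -mulrA; congr (_ * _); rewrite -pevalZ; congr (peval _ _ _).
by apply/funext => w; rewrite fourier_mul_row_gen_rcons.
Qed.

Lemma norm_row_gen_le1 : `|row_gen| <= 1.
Proof.
rewrite ncdisc_normE -[leRHS]/((1 : R)%:C) lecR.
apply: opnorm_le_sqr => // y; rewrite expr1n mul1r -lee_fin -!sqsum_norm.
rewrite sqsum_cons.
have row0 : (row_gen : fock_op R n) y [::] = 0.
  by rewrite toeplitz convol_nil -[row_gen]mulr1 row_gen_fourier_nil mul0r.
rewrite row0 sqmod0 add0e.
apply: (@le_trans _ _ (\sum_(i < n) ((sqmod (x i))%:E * sqsum y))%E); last first.
  rewrite -ge0_sume_distrl => [|i _]; last by rewrite lee_fin sqmod_ge0.
  by rewrite sumEFin x1 mul1e.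
apply: lee_sum => i _; rewrite [X in (X <= _)%E](_ : _ =
    sqsum (Num.conj (x i) *: fock_val y)).
  apply: le_trans (sqsumZ _ _) _.
  rewrite [sqmod (Num.conj _)](_ : _ = sqmod (x i))// /sqmod.
  by case: (x i) => a b /=; rewrite sqrrN.
congr sqsum; apply/funext => w.
rewrite toeplitz convol_cons -[row_gen]mulr1 row_gen_fourier_nil mul0r add0r.
rewrite -[RHS]/(_ * _) -(convol1 y w) /convol mulr_sumr.
by apply: eq_bigr => k _; rewrite row_gen_fourier_cons mulrA.
Qed.

Lemma norm_row_gen_exp_le1 k : `|row_gen ^+ k| <= 1.
Proof.
elim: k => [|k IH]; first exact: ncdisc_norm1.
rewrite exprS; apply: le_trans (ncdisc_normM _ _) _.
by rewrite mulr_ile1// norm_row_gen_le1.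
Qed.

End UnitSphere.

(** * Tangential vector fields and derivations *)

Lemma poly_inj_roots_eq0 (F : idomainType) (p : {poly F}) (f : nat -> F) :
  injective f -> (forall k, p.[f k] = 0) -> p = 0.
Proof.
move=> finj pf; apply/eqP/negPn/negP => p0.
have := max_poly_roots p0 (rs := map f (iota 0 (size p))).
rewrite size_map size_iota ltnn map_inj_uniq// iota_uniq => /(_ _ isT).
suff -> : all (root p) (map f (iota 0 (size p))) by move=> /(_ isT).
by apply/allP => _ /mapP[k _ ->]; apply/eqP/pf.
Qed.

(** A holomorphic homogeneous vector field tangent to the spheres is zero. Along
    the line [x + t e_j] the hypothesis reads [P(t) + t^* Q(t) = 0] for two
    polynomials [P] and [Q], where [Q(t)] is the value of the [j]-th component.
    Real values of [t] give [P = - t Q], then imaginary values give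
    [2 t Q(t) = 0], so that [Q] has infinitely many roots. *)
Lemma tangential_peval_eq0 (F : numClosedFieldType) (n d : nat)
    (c : 'I_n -> seq 'I_n -> F) :
  (forall x : 'I_n -> F, \sum_i Num.conj (x i) * peval x d (c i) = 0) ->
  forall x j, peval x d (c j) = 0.
Proof.
move=> tan x j.
pose L i : {poly F} := (x i)%:P + (i == j)%:R *: 'X.
pose Q := hpoly L d (c j).
pose P := \sum_i (Num.conj (x i))%:P * hpoly L d (c i).
have PQ t : P.[t] + Num.conj t * Q.[t] = 0.
  rewrite -[RHS](tan (fun i => (L i).[t])) /P horner_sum.
  under [RHS]eq_bigr do rewrite -horner_hpoly.
  have -> : Num.conj t * Q.[t] =
      \sum_i (i == j)%:R * Num.conj t * (hpoly L d (c i)).[t].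
    rewrite (bigD1 j)//= eqxx mul1r big1 ?addr0// => i /negbTE->.
    by rewrite !mul0r.
  rewrite -big_split; apply: eq_bigr => i _ /=.
  rewrite hornerM hornerC -mulrDl /L hornerD hornerC hornerZ hornerX.
  by rewrite rmorphD rmorphM rmorph_nat.
have natr_inj : injective (fun k : nat => k%:R : F).
  by move=> k l /eqP; rewrite eqr_nat => /eqP.
have PXQ : P + 'X * Q = 0.
  apply: (poly_inj_roots_eq0 natr_inj) => k.
  by rewrite hornerD hornerM hornerX -[RHS](PQ k%:R) conjC_nat.
have Q0 : Q = 0.
  apply: (@poly_inj_roots_eq0 _ Q (fun k => 'i * k.+1%:R)) => [k l|k].
    by move=> /(mulfI (neq0Ci F))/natr_inj[].
  set t := 'i * _.
  have t_neq0 : t != 0 by rewrite mulf_neq0 ?neq0Ci ?pnatr_eq0.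
  have tC : Num.conj t = - t by rewrite rmorphM /= conjCi conjC_nat mulNr.
  have PXQt : P.[t] + t * Q.[t] = 0.
    by have := congr1 (horner^~ t) PXQ; rewrite hornerD hornerM hornerX horner0.
  have : t * Q.[t] *+ 2 = 0.
    transitivity (P.[t] + t * Q.[t] - (P.[t] + Num.conj t * Q.[t])).
      by rewrite tC; ring.
    by rewrite PXQt PQ subrr.
  by move/eqP; rewrite mulrn_eq0/= mulf_eq0 (negbTE t_neq0) => /eqP.
have := horner0 (0 : F); rewrite -Q0 horner_hpoly => <-.
congr (peval _ _ _); apply/funext => i.
by rewrite /L hornerD hornerC hornerZ hornerX mulr0 addr0.
Qed.

Section DerivationTangent.
Variables (R : realType) (n : nat).
Local Notation C := R[i].
Local Notation word := (seq 'I_n).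
Local Notation A := (ncdisc R n).
Local Notation gen := (@ncdisc_gen R n).
Variable D : {linear A -> A}.
Hypothesis D_continuous : continuous D.
Hypothesis D_derivation : forall a b : A, D (a * b) = D a * b + a * D b.

(** Evaluation at [x] cannot tell the position of the factor [D (row_gen x)] in
    the Leibniz expansion of [D (row_gen x ^+ k.+1)]. *)
Lemma peval_derivation_power (x : 'I_n -> C) d k :
  \sum_i sqmod (x i) = 1 ->
  peval x (d + k) (fourier (D (row_gen x ^+ k.+1))) =
  k.+1%:R * peval x d (fourier (D (row_gen x))).
Proof.
move=> x1; elim: k => [|k IH]; first by rewrite addn0 expr1 mul1r.
have pevalD (a b : A) e : peval x e (fourier (a + b)) =
    peval x e (fourier a) + peval x e (fourier b).
  by rewrite /peval -big_split; apply: eq_bigr => w _; rewrite /= -mulrDl.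
rewrite exprS D_derivation pevalD addnS peval_row_gen_mul// IH.
rewrite [k.+2%:R]mulrS mulrDl mul1r; congr (_ + _).
elim: k {IH} => [|k IH]; first by rewrite addn0 expr1 peval_mul_row_gen.
by rewrite exprSr mulrA addnS peval_mul_row_gen.
Qed.

(** The powers of [row_gen x] are contractions, so that their images under [D]
    are bounded, while the values at [x] grow linearly with the exponent. *)
Lemma peval_derivation_row_gen (x : 'I_n -> C) d :
  \sum_i sqmod (x i) = 1 -> peval x d (fourier (D (row_gen x))) = 0.
Proof.
move=> x1; have [M M0 DM] := continuous_linear_lipschitz D_continuous.
apply: (@bounded_multiples_eq0 _ _ M) => k.
rewrite -[X in X * _](normr_nat C) -normrM -peval_derivation_power//.
apply: le_trans (norm_peval_sphere_le x1 _ _) _.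
apply: le_trans (DM _) _.
by rewrite ler_piMr// norm_row_gen_exp_le1.
Qed.

(** Expanding [row_gen x] gives the claim on the unit sphere; the other points
    follow by homogeneity. *)
Lemma derivation_tangent (x : 'I_n -> C) d :
  \sum_i Num.conj (x i) * peval x d (fourier (D (gen i))) = 0.
Proof.
have unit_case (y : 'I_n -> C) : \sum_i sqmod (y i) = 1 ->
    \sum_i Num.conj (y i) * peval y d (fourier (D (gen i))) = 0.
  move=> y1; rewrite -[RHS](peval_derivation_row_gen d y1).
  under eq_bigr do rewrite -pevalZ.
  rewrite -peval_sum; congr (peval _ _ _); apply/funext => w.
  rewrite /row_gen linear_sum linear_sum/= fct_sumE.
  by apply: eq_bigr => i _; rewrite linearZ linearZ.
pose s := \sum_i sqmod (x i).
have s0 : 0 <= s by apply: sumr_ge0 => i _; exact: sqmod_ge0.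
have [s_eq0|s_neq0] := eqVneq s 0.
  rewrite big1// => i _.
  have := psumr_eq0P (fun i _ => sqmod_ge0 (x i)) s_eq0 => /(_ i isT).
  by move/sqmod_eq0 ->; rewrite rmorph0 mul0r.
pose r : C := (Num.sqrt s)^-1%:C.
have r_neq0 : r != 0.
  by rewrite fmorph_eq0 invr_eq0 sqrtr_eq0 -ltNge lt_neqAle eq_sym s_neq0.
have r1 : \sum_i sqmod (r * x i) = 1.
  under eq_bigr do rewrite sqmodM.
  by rewrite -mulr_sumr sqmod_real exprVn sqr_sqrtr// mulVf.
have := unit_case _ r1.
under eq_bigr do rewrite peval_scale rmorphM mulrACA.
rewrite -mulr_sumr => /eqP; rewrite mulf_eq0 mulf_eq0 expf_eq0 conjC_eq0.
by rewrite (negbTE r_neq0) andbF => /eqP.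
Qed.

Lemma peval_derivation_gen_eq0 (x : 'I_n -> C) d j :
  peval x d (fourier (D (gen j))) = 0.
Proof.
apply: (@tangential_peval_eq0 _ _ d (fun i => fourier (D (gen i)))) => y.
exact: derivation_tangent.
Qed.

End DerivationTangent.

(** * Homogeneous elements of a closed ideal that contains the commutators *)

Lemma digits_inj B n (a b : 'I_n -> nat) :
  (forall i, a i < B)%N -> (forall i, b i < B)%N ->
  (\sum_i a i * B ^ i = \sum_i b i * B ^ i)%N -> a =1 b.
Proof.
elim: n a b => [|n IH] a b aB bB; first by move=> _ [].
rewrite !big_ord_recl !expn0 !muln1.
have shift (c : 'I_n.+1 -> nat) : (\sum_(i < n) c (lift ord0 i) * B ^ lift ord0 i
    = (\sum_(i < n) c (lift ord0 i) * B ^ i) * B)%N.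
  by rewrite big_distrl; apply: eq_bigr => i _; rewrite /= expnSr mulnA.
rewrite !shift => E.
have B0 : (0 < B)%N by apply: leq_ltn_trans (aB ord0).
have ab0 : a ord0 = b ord0.
  have /(congr1 (modn^~ B)) := E.
  by rewrite (addnC (a ord0)) (addnC (b ord0)) !modnMDl !modn_small.
have abS : a \o lift ord0 =1 b \o lift ord0.
  apply: IH => [i|i|]; rewrite /= ?aB ?bB//.
  by apply/eqP; rewrite -(eqn_pmul2r B0) -(eqn_add2l (a ord0)) {2}ab0; apply/eqP.
by move=> i; case: (unliftP ord0 i) => [j ->|->]; [exact: abS|].
Qed.

Section Kronecker.
Variables (n d : nat).
Local Notation word := (seq 'I_n).

(** The exponent of [t] in the monomial of [w] under Kronecker's substitution
    of [t ^ ((d + 1) ^ i)] for the [i]-th variable. In degree [d] each letter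
    occurs at most [d] times, so the digits of the code in base [d + 1] are the
    numbers of occurrences of the letters. *)
Definition kcode (w : word) : nat := \sum_(i <- w) d.+1 ^ i.

Lemma kcodeE w : kcode w = (\sum_(i < n) count_mem i w * d.+1 ^ i)%N.
Proof.
elim: w => [|j w IH]; first by rewrite /kcode big_nil big1.
rewrite /kcode big_cons -/(kcode w) IH /=.
under [RHS]eq_bigr do rewrite mulnDl.
rewrite big_split/=; congr (_ + _)%N.
rewrite (bigD1 j)//= eqxx mul1n big1 ?addn0// => i ij.
by rewrite eq_sym (negbTE ij).
Qed.

Lemma kcode_perm w1 w2 : w1 \in words n d -> w2 \in words n d ->
  kcode w1 = kcode w2 -> perm_eq w1 w2.
Proof.
move=> /size_words s1 /size_words s2; rewrite !kcodeE => /digits_inj E.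
apply/allP => i _ /=; apply/eqP; apply: E => j.
  by rewrite ltnS -s1 count_size.
by rewrite ltnS -s2 count_size.
Qed.

Lemma peval_eq0_kcode (F : numFieldType) (c : word -> F) :
  (forall x : 'I_n -> F, peval x d c = 0) ->
  forall m, \sum_(w <- words n d | kcode w == m) c w = 0.
Proof.
move=> c0 m.
pose Q := hpoly (fun i : 'I_n => 'X^(d.+1 ^ i) : {poly F}) d c.
have Q0 : Q = 0.
  apply: (@poly_inj_roots_eq0 _ Q (fun k => k%:R)) => [k l /eqP|k].
    by rewrite eqr_nat => /eqP.
  by rewrite horner_hpoly c0.
rewrite -[RHS](coef0 F m) -Q0 coef_sum big_mkcond; apply: eq_bigr => w _.
rewrite coefZ -expr_sum coefXn eq_sym.
by case: eqP; rewrite ?mulr1 ?mulr0.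
Qed.

End Kronecker.

Section CommutatorIdeal.
Variables (R : realType) (n : nat).
Local Notation C := R[i].
Local Notation word := (seq 'I_n).
Local Notation A := (ncdisc R n).
Local Notation gen := (@ncdisc_gen R n).
Variable I : set A.
Hypothesis I_ideal : closed_ideal I.
Hypothesis I_comm : forall a b : A, I (a * b - b * a).

Lemma closed_ideal0 : I 0. Proof. by case: I_ideal. Qed.

Lemma closed_idealD a b : I a -> I b -> I (a + b).
Proof. by case: I_ideal => _ _ + _; apply. Qed.

Lemma closed_idealMl a b : I b -> I (a * b).
Proof. by case: I_ideal => _ _ _ h /(h a)[]. Qed.

Lemma closed_idealMr a b : I b -> I (b * a).
Proof. by case: I_ideal => _ _ _ h /(h a)[]. Qed.

Lemma closed_idealZ (l : C) a : I a -> I (l *: a).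
Proof. by move=> Ia; rewrite -mulr_algl; exact: closed_idealMl. Qed.

Lemma closed_ideal_sum (T : eqType) (r : seq T) (P : pred T) (F : T -> A) :
  (forall i, i \in r -> P i -> I (F i)) -> I (\sum_(i <- r | P i) F i).
Proof.
move=> IF; rewrite big_seq_cond; apply: big_ind => [||i /andP[]].
- exact: closed_ideal0.
- exact: closed_idealD.
- exact: IF.
Qed.

(** Any permutation is reached by exchanging adjacent blocks. *)
Lemma closed_ideal_perm_prod w1 w2 : perm_eq w1 w2 ->
  I (\prod_(i <- w1) gen i - \prod_(i <- w2) gen i).
Proof.
move=> w12; pose P w := I (\prod_(i <- w1) gen i - \prod_(i <- w) gen i).
suff : P w2 by [].
apply: (@catCA_perm_ind _ P _ _ _ w12); last first.
  by rewrite /P subrr; exact: closed_ideal0.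
move=> s1 s2 s3; rewrite /P !big_cat/= => I1.
set a := \prod_(i <- s1) gen i; set b := \prod_(i <- s2) gen i.
set c := \prod_(i <- s3) gen i.
rewrite -[X in I X](subrKA (a * (b * c))); apply: closed_idealD => //.
by rewrite !mulrA -mulrBl; apply: closed_idealMr; exact: I_comm.
Qed.

(** Modulo the ideal each monomial may be replaced by a chosen one with the same
    letters; the coefficients that are then collected on a chosen monomial are
    those of the abelianization, hence add up to zero. *)
Lemma closed_ideal_hpoly d (c : word -> C) :
  (forall x : 'I_n -> C, peval x d c = 0) -> I (hpoly gen d c).
Proof.
move=> c0.
pose code := @kcode n d.
(* the chosen word among those of code m *)
pose rep m := head [::] [seq w <- words n d | code w == m].
have repP w : w \in words n d -> rep (code w) \in words n d /\
    code (rep (code w)) = code w.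
  move=> wd; suff : rep (code w) \in [seq v <- words n d | code v == code w].
    by rewrite mem_filter => /andP[/eqP].
  rewrite /rep; have : w \in [seq v <- words n d | code v == code w].
    by rewrite mem_filter eqxx.
  by case: [seq _ <- _ | _] => // v s _; exact: mem_head.
pose G m := \prod_(i <- rep m) gen i.
pose M := (\max_(w <- words n d) code w).+1.
have -> : hpoly gen d c = \sum_(w <- words n d)
    c w *: (\prod_(i <- w) gen i - G (code w)).
  under eq_bigr do rewrite scalerBr.
  rewrite sumrB [X in _ - X](_ : _ = 0) ?subr0//.
  rewrite (eq_big_seq (fun w => \sum_(m < M | code w == m) c w *: G m)).
    rewrite (exchange_big_dep predT)//= big1// => m _.
    by rewrite -scaler_suml peval_eq0_kcode// scale0r.
  move=> w wd.
  have wM : (code w < M)%N by rewrite ltnS; exact: leq_bigmax_seq.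
  by rewrite (big_pred1 (Ordinal wM)).
apply: closed_ideal_sum => w wd _; apply: closed_idealZ.
apply: closed_ideal_perm_prod.
have [rw rE] := repP w wd; exact: (kcode_perm wd rw (esym rE)).
Qed.

End CommutatorIdeal.

(** * Fejer means *)

Section Esum.
Variable R : realType.

Lemma esum_exchange (T1 T2 : choiceType) (a : T1 -> T2 -> \bar R) :
  (forall i j, 0 <= a i j)%E ->
  (\esum_(i in [set: T1]) \esum_(j in [set: T2]) a i j =
   \esum_(j in [set: T2]) \esum_(i in [set: T1]) a i j)%E.
Proof.
move=> a0.
rewrite (@esum_esum _ _ _ setT (fun=> setT))//.
rewrite (@esum_esum _ _ _ setT (fun=> setT))//.
rewrite (reindex_esum (setT `*`` (fun=> setT)) _ (fun x : T2 * T1 => (x.2, x.1)))//.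
split=> //=; first by move=> [i j] [i' j'] /= _ _ [-> ->].
by move=> [i j] _ /=; exists (j, i).
Qed.

Lemma sum_le_esum_nat (g : nat -> \bar R) m k : (forall t, 0 <= g t)%E ->
  (\sum_(s < k) g (m + s)%N <= \esum_(t in [set: nat]) g t)%E.
Proof.
move=> g0; apply: esum_ge; exists `I_(m + k); first by split=> //; exact: finite_II.
rewrite -fsbig_ord -(big_mkord xpredT (fun s => g (m + s)%N)) -(big_mkord xpredT g).
rewrite [X in (_ <= X)%E](big_cat_nat (n := m))//= ?leq_addr//.
have -> : (\sum_(m <= t < m + k) g t = \sum_(0 <= s < k) g (m + s)%N)%E.
  rewrite -[X in index_iota X _]add0n big_addn addKn.
  by apply: eq_bigr => s _; rewrite addnC.
by rewrite leeDr// sume_ge0.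
Qed.

Lemma esum_nat_window (r : R) m k : 0 <= r ->
  (\esum_(t in [set: nat]) (if (m <= t < m + k)%N then r else 0)%:E
   <= (k%:R * r)%:E)%E.
Proof.
move=> r0; rewrite (esumID `I_(m + k))//; last first.
  by move=> t _; case: ifP => _; rewrite lee_fin.
rewrite setTI setTI [X in (_ + X)%E]esum1 => [|t /= /negP]; last first.
  by rewrite -leqNgt => mkt; rewrite ltnNge mkt andbF.
rewrite adde0 esum_fset//; last by move=> t _; case: ifP => _; rewrite lee_fin.
rewrite -fsbig_ord sumEFin lee_fin.
rewrite -(big_mkord xpredT (fun t => if (m <= t < m + k)%N then r else 0)).
rewrite (big_cat_nat (n := m))//= ?leq_addr//.
rewrite big_nat big1 => [|t /andP[_ tm]]; last by rewrite leqNgt tm.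
rewrite add0r (eq_big_nat _ _ (F2 := fun=> r)) => [|t ->]//.
by rewrite sumr_const_nat addKn mulr_natl.
Qed.

End Esum.

(** The number of windows of length [m] that contain two given positions at
    distance [k], which is where the Fejer weights come from. *)
Lemma sum_ltn_shift k m : (\sum_(s < m) (s + k < m) = m - k)%N.
Proof.
elim: m => [|m IH]; first by rewrite big_ord0.
rewrite big_ord_recl add0n /= ltnS.
under eq_bigr do rewrite /bump/= add1n addSn ltnS.
rewrite IH; lia.
Qed.

Section Fejer.
Variables (R : realType) (n : nat).
Local Notation C := R[i].
Local Notation word := (seq 'I_n).
Local Notation fock := (fock R n).
Local Notation A := (ncdisc R n).
Local Notation gen := (@ncdisc_gen R n).
Implicit Types (x : fock) (a b p : A) (u v w : word).

Lemma fourier_hpoly d (c : word -> C) w :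
  fourier (hpoly gen d c : A) w = if size w == d then c w else 0.
Proof.
elim: d c w => [|d IH] c w.
  rewrite hpoly0 linearZ /= -[LHS]/(_ * _) /fourier /= /vacuum_fun.
  by case: w => [|i w]; rewrite ?mulr1 ?mulr0.
rewrite hpolyS linear_sum/= fct_sumE.
case: w => [|j w]; first by rewrite big1.
rewrite (bigD1 j)//= big1 ?addr0 => [|i ij].
  by rewrite gen_fourier/= eqxx IH eqSS.
by rewrite gen_fourier/= eq_sym (negbTE ij).
Qed.

(** The truncated subtraction never truncates here, but it makes
    [fourier_fejer] hold for words of any length. *)
Definition fejer N a : A :=
  \sum_(d < N.+1) ((N.+1 - d)%:R / N.+1%:R) *: hpoly gen d (fourier a).

Lemma fourier_fejer N a w :
  fourier (fejer N a) w = (N.+1 - size w)%:R / N.+1%:R * fourier a w.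
Proof.
rewrite /fejer linear_sum/= fct_sumE.
under eq_bigr do rewrite linearZ/= -[(_ *: _) w]/(_ * _) fourier_hpoly.
have [wN|Nw] := ltnP (size w) N.+1.
  rewrite (bigD1 (Ordinal wN))//= eqxx big1 ?addr0// => d dw.
  by rewrite ifN ?mulr0// eq_sym; apply: contra_neq dw => dw; exact: val_inj.
rewrite (eqnP Nw) mul0r mul0r big1// => d _.
by rewrite ifN ?mulr0// gtn_eqF// (leq_trans _ Nw).
Qed.

(** The window [t - K < size v <= t] is indexed by its upper end, so that every
    nonempty window has a natural number as index. *)
Definition window_fun K x t v : C :=
  if (size v <= t < size v + K)%N then x v else 0.

Lemma window_summable K x t : window_fun K x t \in @square_summable R n.
Proof.
apply/asboolP; apply: le_lt_trans (_ : (sqsum x < +oo)%E).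
  apply: le_esum => v _; rewrite lee_fin /window_fun.
  by case: ifP => // _; rewrite sqmod0 sqmod_ge0.
exact/asboolP/(fock_valP x).
Qed.

Definition window K x t : fock := Fock (window_summable K x t).

(** The homogeneous component of degree [k] contributes to the [u]-th coordinate
    through the word [drop k u], of length [size u - k]. Among the [N + 1]
    windows that contain [size u], those that contain this length as well are
    [N + 1 - k] in number, up to the normalization the weight in [fejer]. *)
Lemma fejer_window N a x u :
  N.+1%:R * (fejer N a : fock_op R n) x u =
  \sum_(s < N.+1) (a : fock_op R n) (window N.+1 x (size u + s)) u.
Proof.
under [RHS]eq_bigr do rewrite toeplitz.
rewrite toeplitz /convol exchange_big mulr_sumr; apply: eq_bigr => k _ /=.
have ku : (k <= size u)%N by rewrite -ltnS.
rewrite fourier_fejer size_takel//.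
set f := fourier a _; set y := fock_val _ _.
have -> : N.+1%:R * ((N.+1 - k)%:R / N.+1%:R * f * y) = (N.+1 - k)%:R * (f * y).
  by field; rewrite addrC natr1 pnatr_eq0.
rewrite mulr_natl -(sum_ltn_shift k N.+1) -sumrMnr; apply: eq_bigr => s _.
rewrite /window_fun size_drop.
rewrite (_ : (_ <= _ < _)%N = (s + k < N.+1)%N); last by apply/idP/idP; lia.
by case: (_ < _)%N; rewrite ?mulr0 ?mulr0n ?mulr1n.
Qed.

Lemma esum_window K x :
  (\esum_(t in [set: nat]) sqsum (window K x t) <= K%:R%:E * sqsum x)%E.
Proof.
rewrite /sqsum esum_exchange => [|t v]; last by rewrite lee_fin sqmod_ge0.
apply: le_trans (le_esumZ (ler0n _ K) (fun v => sqmod_ge0 (x v))).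
apply: le_esum => v _.
apply: le_trans (esum_nat_window (size v) _ (sqmod_ge0 (x v))).
apply: le_esum => t _; rewrite lee_fin /window /window_fun/=.
by case: ifP; rewrite ?sqmod0.
Qed.

Lemma sqmod_fejer_le N a x u :
  sqmod ((fejer N a : fock_op R n) x u) <= N.+1%:R^-1 *
  \sum_(s < N.+1) sqmod ((a : fock_op R n) (window N.+1 x (size u + s)) u).
Proof.
have N0 : (0 : R) < N.+1%:R by rewrite ltr0n.
have := sqmod_sum_le
  (fun s : 'I_N.+1 => (a : fock_op R n) (window N.+1 x (size u + s)) u).
rewrite -fejer_window sqmodM card_ord -(rmorph_nat (real_complex R)).
by rewrite sqmod_real expr2 -mulrA ler_pM2l// ler_pdivlMl.
Qed.

(** By [fejer_window] the Fejer mean is an average of compressions of [a] to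
    windows. Cauchy-Schwarz over the [N + 1] windows that contain a given word,
    followed by exchanging the sums over words and windows, bounds its square
    norm at [x] by [opnorm a ^+ 2 / (N + 1)] times the sum of the square norms of
    the windows of [x], and each coordinate of [x] lies in [N + 1] windows. *)
Lemma opnorm_fejer_le N a : opnorm (fejer N a) <= opnorm a.
Proof.
apply: opnorm_le_sqr => [|x]; first exact: opnorm_ge0.
rewrite -lee_fin -sqsum_norm.
pose g t u := (sqmod ((a : fock_op R n) (window N.+1 x t) u))%:E.
have g0 t u : (0 <= g t u)%E by rewrite lee_fin sqmod_ge0.
have N0 : (0 : R) <= N.+1%:R^-1 by rewrite invr_ge0.
apply: (@le_trans _ _ (N.+1%:R^-1%:E *
    \esum_(u in [set: word]) \sum_(s < N.+1) g (size u + s)%N u)%E).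
  under [X in (_ <= _ * X)%E]eq_esum do rewrite /g sumEFin.
  apply: le_trans (le_esumZ N0 _); last first.
    by move=> u; apply: sumr_ge0 => s _; exact: sqmod_ge0.
  by apply: le_esum => u _; rewrite lee_fin sqmod_fejer_le.
rewrite -[leRHS]mul1e -[1%E](_ : (N.+1%:R^-1 * N.+1%:R)%:E = _); last first.
  by rewrite mulVf// pnatr_eq0.
rewrite EFinM -muleA; apply: lee_wpmul2l; first by rewrite lee_fin.
apply: (@le_trans _ _ (\esum_(u in [set: word]) \esum_(t in [set: nat]) g t u)%E).
  by apply: le_esum => u _; exact: (sum_le_esum_nat (size u)).
rewrite esum_exchange => [|u t]; last exact: g0.
apply: (@le_trans _ _ (\esum_(t in [set: nat])
    (opnorm a ^+ 2 * fock_norm (window N.+1 x t) ^+ 2)%:E)%E).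
  apply: le_esum => t _; rewrite -[leLHS]/(sqsum _) sqsum_norm lee_fin -exprMn.
  by rewrite ler_sqr ?nnegrE ?mulr_ge0 ?opnorm_ge0 ?fock_norm_ge0// opnormP.
apply: le_trans (le_esumZ _ _) _; [exact: sqr_ge0|by move=> t; exact: sqr_ge0|].
rewrite [X in (_ <= _ * X)%E]EFinM muleCA.
apply: lee_wpmul2l; first by rewrite lee_fin sqr_ge0.
rewrite -sqsum_norm; apply: le_trans (esum_window _ _).
by apply: le_esum => t _; rewrite -sqsum_norm.
Qed.

Lemma norm_fejer_le N a : `|fejer N a| <= `|a|.
Proof. by rewrite !ncdisc_normE lecR opnorm_fejer_le. Qed.

Lemma fejerB N a b : fejer N (a - b) = fejer N a - fejer N b.
Proof.
apply: fourier_inj; apply/funext => w; rewrite fourier_fejer.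
rewrite -[RHS]/(fourier (fejer N a) w - fourier (fejer N b) w) !fourier_fejer.
by rewrite -mulrBr.
Qed.

Definition finitely_supported p :=
  exists K, forall w, (K <= size w)%N -> fourier p w = 0.

Lemma fejer_cvg_finite p (e : C) : finitely_supported p -> 0 < e ->
  exists N, `|fejer N p - p| < e.
Proof.
move=> [K pK] e0.
(* the error is - T / (N + K + 1), with T independent of N *)
pose T : A := \sum_(d < K) d%:R *: hpoly gen d (fourier p).
have [N TN] := @archi_complex _ (`|T| / e) (divr_ge0 (normr_ge0 _) (ltW e0)).
exists (N + K)%N; set M := (N + K).+1.
have M0 : (0 : C) < M%:R by rewrite ltr0n.
have -> : fejer (N + K) p - p = - (M%:R^-1 *: T).
  apply: fourier_inj; apply/funext => w.
  rewrite -[LHS]/(fourier (fejer (N + K) p) w - fourier p w) fourier_fejer.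
  rewrite -[RHS]/(- (_ * fourier T w)) /T linear_sum/= fct_sumE.
  under eq_bigr do rewrite linearZ/= -[(_ *: _) w]/(_ * _) fourier_hpoly.
  have [wK|Kw] := ltnP (size w) K; last first.
    rewrite pK// mulr0 subrr big1 ?mulr0 ?oppr0// => d _.
    by rewrite ifN ?mulr0// gtn_eqF// (leq_trans _ Kw).
  rewrite (bigD1 (Ordinal wK))//= eqxx big1 ?addr0 => [|d dw]; last first.
    by rewrite ifN ?mulr0// eq_sym; apply: contra_neq dw => dw; exact: val_inj.
  rewrite -/M natrB; last by rewrite /M; lia.
  by field; rewrite gt_eqF.
rewrite normrN normrZ ger0_norm ?invr_ge0 ?ltW// mulrC ltr_pdivrMr//.
rewrite -ltr_pdivrMl// mulrC; apply: lt_le_trans TN _.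
by rewrite ler_nat /M; lia.
Qed.

Lemma finitely_supported_dense a (e : C) : 0 < e ->
  exists2 p, finitely_supported p & `|a - p| < e.
Proof.
move: a e.
suff h a : [set a | forall e : C, 0 < e ->
  exists2 p, finitely_supported p & `|a - p| < e] a by move=> a e; exact: h.
move: a; apply: ncdisc_ind => [||l a b Va Vb e e0|i a Va e e0].
- apply/(@closed_normP C A) => a aI e e0.
  have e2 : 0 < e / 2%:R by rewrite divr_gt0.
  have [b Vb ab] := aI _ e2; have [p pf bp] := Vb _ e2.
  exists p => //; rewrite -(subrKA b); apply: le_lt_trans (ler_normD _ _) _.
  by rewrite [e]splitr ltrD.
- move=> e e0; exists 1; last by rewrite subrr normr0.
  by exists 1%N => -[].
- have e2 : 0 < e / 2%:R by rewrite divr_gt0.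
  have l1 : 0 < 1 + `|l| by rewrite ltr_wpDr.
  have [p [K pK] ap] := Va _ (divr_gt0 e2 l1).
  have [q [M qM] bq] := Vb _ e2.
  exists (l *: p + q).
    exists (maxn K M) => w; rewrite geq_max => /andP[Kw Mw].
    by rewrite linearP/= -[LHS]/(l * _ + _) pK// qM// mulr0 addr0.
  rewrite opprD addrACA -scalerBr; apply: le_lt_trans (ler_normD _ _) _.
  rewrite [e]splitr normrZ ler_ltD//.
  apply: le_trans (ler_wpM2l _ (ltW ap)) _ => //.
  by rewrite mulrCA ler_piMr ?(ltW e2)// ler_pdivrMr// mul1r lerDr.
- have i1 : 0 < 1 + `|gen i| by rewrite ltr_wpDr.
  have [p [K pK] ap] := Va _ (divr_gt0 e0 i1).
  exists (gen i * p).
    exists K.+1 => -[|j w]//= Kw; rewrite gen_fourier/= pK//.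
    by case: ifP.
  rewrite -mulrBr; apply: le_lt_trans (ncdisc_normM _ _) _.
  apply: le_lt_trans (ler_wpM2l _ (ltW ap)) _ => //.
  by rewrite mulrCA gtr_pMr// ltr_pdivrMr// mul1r ltrDr.
Qed.

(** The Fejer means are uniformly bounded and converge on the dense subspace of
    the finitely supported elements. *)
Lemma fejer_cvg a (e : C) : 0 < e -> exists N, `|fejer N a - a| < e.
Proof.
move=> e0; have e2 : 0 < e / 2%:R by rewrite divr_gt0.
have e4 : 0 < e / 2%:R / 2%:R by rewrite divr_gt0.
have [p pf ap] := finitely_supported_dense a e4.
have [N pN] := fejer_cvg_finite pf e2; exists N.
have -> : fejer N a - a = fejer N p - p + (fejer N (a - p) + (p - a)).
  by rewrite [RHS]addrCA fejerB !subrKA.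
apply: le_lt_trans (ler_normD _ _) _; rewrite [e]splitr.
apply: ltrD => //; apply: le_lt_trans (ler_normD _ _) _; rewrite [e / 2%:R]splitr.
apply: ltrD; last by rewrite distrC.
exact: le_lt_trans (norm_fejer_le _ _) ap.
Qed.

End Fejer.

(** * The range of a derivation *)

(** The Fejer means of [a] are combinations of its homogeneous components, which
    lie in [I], and they converge to [a]. *)
Lemma ideal_of_peval_eq0 (R : realType) (n : nat) (I : set (ncdisc R n)) a :
  closed_ideal I -> (forall b c : ncdisc R n, I (b * c - c * b)) ->
  (forall (x : 'I_n -> R[i]) d, peval x d (fourier a) = 0) -> I a.
Proof.
move=> I_ideal I_comm a0; have [I_closed _ _ _] := I_ideal.
move/(@closed_normP R[i] (ncdisc R n)) : I_closed; apply => e e0.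
have [N aN] := fejer_cvg a e0; exists (fejer N a); last by rewrite distrC.
apply: closed_ideal_sum => // d _ _; apply: closed_idealZ => //.
by apply: closed_ideal_hpoly => // x; exact: a0.
Qed.

Theorem proposition5p10 (R : realType) (n : nat) (n_ge1 : (1 <= n)%N)
    (D : {linear ncdisc R n -> ncdisc R n}) (D_continuous : continuous D)
    (D_derivation : forall a b : ncdisc R n, D (a * b) = D a * b + a * D b) :
  range D `<=` commutator_ideal R n.
Proof.
move=> _ [a _ <-] I [I_ideal I_sub].
have I_comm (b c : ncdisc R n) : I (b * c - c * b) by apply: I_sub; exists b, c.
have I_gen i : I (D (ncdisc_gen R i)).
  apply: ideal_of_peval_eq0 => // x d; exact: peval_derivation_gen_eq0.
suff : [set a | I (D a)] a by [].
move: a; apply: ncdisc_ind => [||l a b /= Ia Ib|i a /= Ia].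
- by apply: preimage_closed; [move=> b _; exact: D_continuous|case: I_ideal].
- have /eqP := D_derivation 1 1.
  rewrite !mulr1 mul1r -subr_eq0 opprD addrA subrr sub0r oppr_eq0 /= => /eqP ->.
  exact: (closed_ideal0 I_ideal).
- by rewrite linearP; apply: closed_idealD => //; exact: (closed_idealZ I_ideal).
- rewrite D_derivation; apply: (closed_idealD I_ideal).
    exact: (closed_idealMr I_ideal _ (I_gen i)).
  exact: (closed_idealMl I_ideal _ Ia).
Qed.
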